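(* Let $f\colon\mathbb{R}^n\times\mathbb{R}^m\to\mathbb{R}$ be continuously differentiable, and let $A\in\mathbb{R}^{p\times n}$, $B\in\mathbb{R}^{p\times m}$, $C\in\mathbb{R}^{q\times n}$, $D\in\mathbb{R}^{q\times m}$, $b\in\mathbb{R}^p$, $c\in\mathbb{R}^m$, $d\in\mathbb{R}^q$. For $x\in\mathbb{R}^n$ let $\Psi(x)$ denote the (possibly empty) solution set of the linear program $\min_y\{c^\top y\mid Ax+By\le b\}$, and let $\vartheta(x)=\inf_y\{c^\top y\mid Ax+By\le b\}$ be its optimal value. Let $(\bar x,\bar y)\in\mathbb{R}^n\times\mathbb{R}^m$ be a local minimizer of the bilevel optimization problem $$\min_{x,y}\{f(x,y)\mid Cx+Dy\le d,\ y\in\Psi(x)\}$$ and assume that $\bar x\in\operatorname{int}\operatorname{dom}\vartheta$. Then there exist $\lambda,\lambda'\in\mathbb{R}^p$, $\mu\in\mathbb{R}^q$, and $\sigma\ge0$ such that $$\begin{aligned} &0=\nabla_xf(\bar x,\bar y)+A^\top(\lambda-\sigma\lambda')+C^\top\mu,\\ &0=\nabla_yf(\bar x,\bar y)+B^\top(\lambda-\sigma\lambda')+D^\top\mu,\\ &0\le\lambda\perp b-A\bar x-B\bar y,\\ &0\le\mu\perp d-C\bar x-D\bar y,\\ &0=c+B^\top\lambda',\qquad 0\le\lambda'\perp b-A\bar x-B\bar y. \end{aligned}$$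
   Context: $\vartheta\colon\mathbb{R}^n\to\mathbb{R}\cup\{-\infty,\infty\}$ and $\operatorname{dom}\vartheta=\{x\mid|\vartheta(x)|<\infty\}$. Vector inequalities are componentwise; for vectors $u,v$, $0\le u\perp v$ means $u\ge0$ and $u^\top v=0$ (feasibility already gives $b-A\bar x-B\bar y\ge0$ and $d-C\bar x-D\bar y\ge0$). *)

(* Defs.v *)
From HB Require Import structures.
From mathcomp Require Import all_boot all_order all_algebra.
From mathcomp Require Import all_classical all_reals all_analysis.
Set Implicit Arguments.
Unset Strict Implicit.
Unset Printing Implicit Defensive.
Import Order.TTheory GRing.Theory Num.Theory.
Import numFieldNormedType.Exports.
Local Open Scope classical_set_scope.
Local Open Scope ring_scope.

(* Vectors of R^k are columns ['cV[R]_k]. Their topology is that of the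
   max norm, and that of ['cV[R]_n * 'cV[R]_m] is the product one, so all
   notions below agree with the Euclidean ones. *)

Definition dotv (R : realType) (k : nat) (u v : 'cV[R]_k) : R :=
  (u^T *m v) 0 0.

Definition vle (R : realType) (k : nat) (u v : 'cV[R]_k) : Prop :=
  forall i : 'I_k, u i 0 <= v i 0.

(* "0 <= u _|_ v"; [0 <= v] is not part of it. *)
Definition nneg_orth (R : realType) (k : nat) (u v : 'cV[R]_k) : Prop :=
  vle 0 u /\ dotv u v = 0.

Definition grad (R : realType) (k : nat) (g : 'cV[R]_k -> R) (x : 'cV[R]_k) :
    'cV[R]_k :=
  \col_i 'D_(delta_mx i 0) g x.

Definition grad_x (R : realType) (n m : nat) (f : 'cV[R]_n * 'cV[R]_m -> R)
    (z : 'cV[R]_n * 'cV[R]_m) : 'cV[R]_n :=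
  grad (fun x => f (x, z.2)) z.1.

Definition grad_y (R : realType) (n m : nat) (f : 'cV[R]_n * 'cV[R]_m -> R)
    (z : 'cV[R]_n * 'cV[R]_m) : 'cV[R]_m :=
  grad (fun y => f (z.1, y)) z.2.

Definition continuously_differentiable (R : realType) (n m : nat)
    (f : 'cV[R]_n * 'cV[R]_m -> R) : Prop :=
  [/\ forall z, differentiable f z, continuous (grad_x f)
    & continuous (grad_y f)].

Definition local_minimizer (R : realType) (T : topologicalType) (f : T -> R)
    (S : set T) (z : T) : Prop :=
  S z /\ \forall z' \near z, S z' -> f z <= f z'.

Definition edom (R : realType) (T : Type) (g : T -> \bar R) : set T :=
  [set x | (`|g x| < +oo)%E].

Definition lp_feasible (R : realType) (n m p : nat) (A : 'M[R]_(p, n))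
    (B : 'M[R]_(p, m)) (b : 'cV[R]_p) (x : 'cV[R]_n) : set 'cV[R]_m :=
  [set y | vle (A *m x + B *m y) b].

Definition Psi (R : realType) (n m p : nat) (A : 'M[R]_(p, n))
    (B : 'M[R]_(p, m)) (b : 'cV[R]_p) (c : 'cV[R]_m) (x : 'cV[R]_n) :
    set 'cV[R]_m :=
  [set y | lp_feasible A B b x y /\
           forall y', lp_feasible A B b x y' -> dotv c y <= dotv c y'].

(* [+oo] if the program is infeasible, [-oo] if it is unbounded. *)
Definition vartheta (R : realType) (n m p : nat) (A : 'M[R]_(p, n))
    (B : 'M[R]_(p, m)) (b : 'cV[R]_p) (c : 'cV[R]_m) (x : 'cV[R]_n) : \bar R :=
  ereal_inf [set (dotv c y)%:E | y in lp_feasible A B b x].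

Definition bilevel_feasible (R : realType) (n m p q : nat) (A : 'M[R]_(p, n))
    (B : 'M[R]_(p, m)) (C : 'M[R]_(q, n)) (D : 'M[R]_(q, m)) (b : 'cV[R]_p)
    (c : 'cV[R]_m) (d : 'cV[R]_q) : set ('cV[R]_n * 'cV[R]_m) :=
  [set z | vle (C *m z.1 + D *m z.2) d /\ Psi A B b c z.1 z.2].

(* Main.v *)
Require Import Defs.
From HB Require Import structures.
From mathcomp Require Import all_boot all_order all_algebra.
From mathcomp Require Import all_classical all_reals all_analysis.
From mathcomp Require Import ring lra.

(** Fix a dual optimal solution l' of the lower-level program at xb, that is
    l' >= 0 with c + B^T l' = 0 and l' orthogonal to b - A xb - B yb
    ([lp_dual_multiplier]). Dual feasibility does not mention x, so weak
    duality at an arbitrary x gives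

      c^T y - c^T y' <= l'^T (b - A x - B y)

    for all lower-level feasible y and y'. Hence every (x, y) with
    A x + B y <= b and l'^T (b - A x - B y) <= 0 has y in Psi(x)
    ([Psi_complementary]). Consequently the polyhedron

      A x + B y <= b,  C x + D y <= d,  - l'^T A x - l'^T B y <= - l'^T b

    lies inside the feasible set of the bilevel problem. It contains (xb, yb),
    which is therefore a local minimizer of f over it.

    Since its constraints are linear, the Karush-Kuhn-Tucker conditions hold
    on this polyhedron: they follow from Farkas' lemma ([farkas],
    [linear_kkt]) and from the fact that f has nonnegative derivative along
    feasible directions ([local_min_diff_ge0], [diff_grad]).
    The multipliers of the three groups of constraints are lambda, mu and
    sigma; the last row contributes - sigma A^T l' and - sigma B^T l' to the
    two gradient equations, which is exactly the shape A^T (lambda - sigma l')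
    and B^T (lambda - sigma l') of the statement. *)

Import Order.TTheory GRing.Theory Num.Theory.
Import numFieldNormedType.Exports.
Local Open Scope classical_set_scope.
Local Open Scope ring_scope.

Set Implicit Arguments.
Unset Strict Implicit.

(** * Scalar products and componentwise order *)

Lemma dotvE (R : realType) (k : nat) (u v : 'cV[R]_k) :
  dotv u v = \sum_i u i 0 * v i 0.
Proof. by rewrite /dotv mxE; apply: eq_bigr => i _; rewrite mxE. Qed.

Lemma dotvC (R : realType) (k : nat) (u v : 'cV[R]_k) : dotv u v = dotv v u.
Proof. by rewrite !dotvE; apply: eq_bigr => i _; rewrite mulrC. Qed.

Lemma dotvDr (R : realType) (k : nat) (u v w : 'cV[R]_k) :
  dotv u (v + w) = dotv u v + dotv u w.
Proof. by rewrite /dotv mulmxDr mxE. Qed.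

Lemma dotvZr (R : realType) (k : nat) (a : R) (u v : 'cV[R]_k) :
  dotv u (a *: v) = a * dotv u v.
Proof. by rewrite /dotv -scalemxAr mxE. Qed.

Lemma dotvNr (R : realType) (k : nat) (u v : 'cV[R]_k) :
  dotv u (- v) = - dotv u v.
Proof. by rewrite /dotv mulmxN mxE. Qed.

Lemma dotvDl (R : realType) (k : nat) (u v w : 'cV[R]_k) :
  dotv (u + v) w = dotv u w + dotv v w.
Proof. by rewrite ![dotv _ w]dotvC dotvDr. Qed.

Lemma dotvZl (R : realType) (k : nat) (a : R) (u v : 'cV[R]_k) :
  dotv (a *: u) v = a * dotv u v.
Proof. by rewrite ![dotv _ v]dotvC dotvZr. Qed.

Lemma dotv_trmx (R : realType) (k l : nat) (M : 'M[R]_(k, l)) u v :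
  dotv (M^T *m u) v = dotv u (M *m v).
Proof. by rewrite /dotv trmx_mul trmxK mulmxA. Qed.

Lemma dotv_col_mx (R : realType) (k l : nat) (u1 v1 : 'cV[R]_k)
    (u2 v2 : 'cV[R]_l) :
  dotv (col_mx u1 u2) (col_mx v1 v2) = dotv u1 v1 + dotv u2 v2.
Proof. by rewrite /dotv tr_col_mx mul_row_col mxE. Qed.

Lemma dotv_delta (R : realType) (k : nat) (u : 'cV[R]_k) (i : 'I_k) :
  dotv u (delta_mx i 0) = u i 0.
Proof. by rewrite /dotv -colE !mxE. Qed.

Lemma dotv_ge0 (R : realType) (k : nat) (u v : 'cV[R]_k) :
  vle 0 u -> vle 0 v -> 0 <= dotv u v.
Proof.
move=> u0 v0; rewrite dotvE; apply: sumr_ge0 => i _.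
by apply: mulr_ge0; [have := u0 i|have := v0 i]; rewrite mxE.
Qed.

Lemma vle_subr (R : realType) (k : nat) (u v : 'cV[R]_k) :
  vle 0 (v - u) <-> vle u v.
Proof. by split=> uv i; have := uv i; rewrite !mxE subr_ge0. Qed.

Lemma vle_slack (R : realType) (k : nat) (u v w : 'cV[R]_k) :
  vle 0 (w - u - v) <-> vle (u + v) w.
Proof. by rewrite -addrA -opprD; exact: vle_subr. Qed.

Lemma vle_col_mx (R : realType) (k l : nat) (u1 v1 : 'cV[R]_k)
    (u2 v2 : 'cV[R]_l) :
  vle (col_mx u1 u2) (col_mx v1 v2) <-> vle u1 v1 /\ vle u2 v2.
Proof.
split=> [uv|[uv1 uv2] i].
  by split=> i; [have := uv (lshift l i)|have := uv (rshift k i)];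
    rewrite ?col_mxEu ?col_mxEd.
by rewrite !mxE; case: splitP => j _; [exact: uv1|exact: uv2].
Qed.

(** Each block contributes a nonnegative term to the scalar product, so both
    terms vanish as soon as their sum does. *)
Lemma nneg_orth_col_mx (R : realType) (k l : nat) (u1 v1 : 'cV[R]_k)
    (u2 v2 : 'cV[R]_l) :
  vle 0 (col_mx v1 v2) -> nneg_orth (col_mx u1 u2) (col_mx v1 v2) ->
  nneg_orth u1 v1 /\ nneg_orth u2 v2.
Proof.
rewrite /nneg_orth -col_mx0 !vle_col_mx dotv_col_mx.
move=> [v10 v20] [[u10 u20]] /eqP.
have d1 := dotv_ge0 u10 v10; have d2 := dotv_ge0 u20 v20.
by rewrite paddr_eq0// => /andP[/eqP -> /eqP ->].
Qed.

(** * Linear constraints: Farkas' lemma and stationarity *)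

(** Farkas' lemma, by induction on the number of rows of [M]. Split off the
    first row [a]. If the other rows alone already force [g] to be nonnegative,
    [a] gets multiplier zero. Otherwise some [x0] satisfies the other
    inequalities with [g] negative, so that [a] must be positive at [x0].
    Subtracting multiples of [a] from [g] and from the other rows makes them
    all vanish at [x0]; the hypothesis survives, since points may be moved
    along [x0] into the kernel of [a] without changing the modified
    functionals. The multipliers of the smaller system then leave a remainder
    that is a multiple of [a], and the sign conditions on [x0] make its
    coefficient nonnegative. *)
Lemma farkas (R : realType) (N k : nat) (M : 'M[R]_(k, N)) (g : 'cV[R]_N) :
  (forall x, vle (M *m x) 0 -> 0 <= dotv g x) ->
  exists2 l, vle 0 l & g + M^T *m l = 0.
Proof.
elim: k => [|k IH] in M g *.
  move=> gM; exists 0; first by case.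
  (* without rows every direction is allowed: test both signs of a basis
     vector *)
  rewrite mulmx0 addr0; apply/matrixP => i j; rewrite ord1 mxE.
  apply/le_anti; rewrite -dotv_delta gM ?andbT; last by case.
  by rewrite -oppr_ge0 -dotvNr gM//; case.
rewrite -[k.+1]/(1 + k)%N in M *.
rewrite -[M]vsubmxK; move: (usubmx M) (dsubmx M) => a M' {M} gM.
have [gM'|] := pselect (forall x, vle (M' *m x) 0 -> 0 <= dotv g x).
  have [l l0 gl] := IH _ _ gM'.
  exists (col_mx 0 l).
    by rewrite -[X in vle X _]col_mx0 vle_col_mx; split.
  by rewrite tr_col_mx mul_row_col mulmx0 add0r.
move=> /existsNP[x0 /not_implyP[M'x0 /negP]]; rewrite -ltNge => gx0.
pose r := (a *m x0) 0 0.
have r_gt0 : 0 < r.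
  rewrite ltNge; apply/negP => r_le0; move: gx0; apply/negP; rewrite -leNgt.
  apply: gM; rewrite mul_col_mx -[X in vle _ X]col_mx0 vle_col_mx; split => //.
  by move=> i; rewrite ord1 [X in _ <= X]mxE.
(* [a] rescaled to take the value 1 at [x0] *)
pose t := r^-1 *: a.
have tx0 : t *m x0 = 1%:M.
  by rewrite -scalemxAl (mx11_scalar (a *m x0)) -/r scale_scalar_mx mulVf
    ?gt_eqF.
pose M'' := M' - M' *m x0 *m t.
pose g'' := g - dotv g x0 *: t^T.
have [|l l0] := IH M'' g''.
  move=> x M''x.
  (* the projection of [x] onto the kernel of [a], along [x0] *)
  pose x' := x - x0 *m (t *m x).
  have M''E : M'' *m x = M' *m x'.
    by rewrite /M'' /x' mulmxBl mulmxBr !mulmxA.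
  have ax' : a *m x' = 0.
    have tx' : t *m x' = 0 by rewrite mulmxBr mulmxA tx0 mul1mx subrr.
    have -> : a = r *: t by rewrite scalerA divff ?gt_eqF// scale1r.
    by rewrite -scalemxAl tx' scaler0.
  have <- : dotv g x' = dotv g'' x.
    rewrite /x' (mx11_scalar (t *m x)) mul_mx_scalar dotvDr dotvNr dotvZr.
    rewrite dotvDl [dotv (- _) x]dotvC dotvNr [dotv x _]dotvC dotvZl.
    by rewrite [dotv t^T x]/dotv trmxK mulrC.
  apply: gM; rewrite mul_col_mx -[X in vle _ X]col_mx0 vle_col_mx ax'.
  by split=> //; rewrite -M''E.
move=> gl.
(* the coefficient of [a] that balances the multiples of [t] subtracted in
   [g''] and [M''] *)
exists (col_mx (- (r^-1 * (dotv g x0 + dotv (M' *m x0) l)))%:M l).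
  rewrite -[X in vle X _]col_mx0 vle_col_mx; split=> // i.
  rewrite ord1 !mxE eqxx mulr1n oppr_ge0 pmulr_rle0 ?invr_gt0//.
  rewrite -[X in _ <= X]addr0; apply: lerD; first exact: ltW.
  rewrite -oppr_ge0 dotvC -dotvNr dotv_ge0//.
  by rewrite -[- _]add0r; apply/vle_subr.
rewrite -gl tr_col_mx mul_row_col mul_mx_scalar /M'' /g''.
have tE : t^T = r^-1 *: a^T by apply/matrixP => i j; rewrite !mxE.
have -> : (M' - M' *m x0 *m t)^T *m l =
    M'^T *m l - (r^-1 * dotv (M' *m x0) l) *: a^T.
  rewrite linearB/= trmx_mul mulmxBl -[t^T *m _ *m l]mulmxA.
  rewrite (mx11_scalar ((M' *m x0)^T *m l)) -/(dotv _ _) mul_mx_scalar.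
  by rewrite tE scalerA mulrC.
rewrite tE; move: (M'^T *m l) => u.
by apply/matrixP => i j; rewrite !mxE; ring.
Qed.

(** Constraints inactive at [z] stay satisfied along any short segment, so the
    directions to be tested are exactly those on which the active rows are
    nonpositive. Farkas' lemma on the active rows gives the multipliers, and
    those of inactive constraints are zero, which is complementarity.
    Stationarity is assumed along feasible directions only, so that both
    linear and smooth objectives qualify. *)
Lemma linear_kkt (R : realType) (N k : nat) (G : 'M[R]_(k, N)) (h : 'cV[R]_k)
    (z g : 'cV[R]_N) :
  vle (G *m z) h ->
  (forall w, (\forall t \near 0^'+, vle (G *m (z + t *: w)) h) ->
    0 <= dotv g w) ->
  exists2 l, nneg_orth l (h - G *m z) & g + G^T *m l = 0.
Proof.
move=> Gzh stat.
(* the indicator of the active constraints; [diag_mx s *m G] replaces the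
   inactive rows by zero rows, which impose nothing *)
pose s := \row_i ((G *m z) i 0 == h i 0)%:R : 'rV[R]_k.
have [w sGw|l l0 gl] := @farkas R N k (diag_mx s *m G) g.
  apply: stat; apply: filter_forall => i.
  have GE t : (G *m (z + t *: w)) i 0 = (G *m z) i 0 + t * (G *m w) i 0.
    by rewrite mulmxDr -scalemxAr !mxE.
  have := Gzh i; rewrite le_eqVlt => /orP[/eqP act|inact].
    have Gw : (G *m w) i 0 <= 0.
      have := sGw i; rewrite -mulmxA mul_diag_mx mxE [s _ _]mxE act eqxx.
      by rewrite mul1r [X in _ <= X]mxE.
    near=> t; rewrite GE act -[leRHS]addr0 lerD2l mulr_ge0_le0//.
  (* a step length that does not use up the slack; adding 1 avoids dividing
     by zero *)
  pose e := (h i 0 - (G *m z) i 0) / (`|(G *m w) i 0| + 1).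
  have e0 : 0 < e by rewrite divr_gt0 ?subr_gt0// ltr_wpDl.
  near=> t; rewrite GE -lerBrDl.
  have t0 : 0 <= t by near: t; exact: nbhs_right_ge.
  have te : t <= e by near: t; exact: nbhs_right_le.
  apply: (@le_trans _ _ (t * (`|(G *m w) i 0| + 1))).
    by rewrite ler_wpM2l// (le_trans (ler_norm _))// lerDl.
  by rewrite -ler_pdivlMr// ltr_wpDl.
exists (diag_mx s *m l); last by rewrite -gl trmx_mul tr_diag_mx mulmxA.
have sE i : (diag_mx s *m l) i 0 = s 0 i * l i 0 by rewrite mul_diag_mx mxE.
split=> [i|].
  by rewrite sE mxE mulr_ge0//; [rewrite mxE ler0n|have := l0 i; rewrite mxE].
rewrite dotvE big1// => i _; rewrite sE [s _ _]mxE.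
case: eqP => [act|]; last by rewrite !mul0r.
have -> : (h - G *m z) i 0 = h i 0 - (G *m z) i 0 by rewrite !mxE.
by rewrite act subrr mulr0.
Unshelve. all: by end_near. Qed.

(** * First-order conditions for differentiable functions *)

(** The difference quotients along [w] are nonnegative for small positive
    steps, and so is their limit. *)
Lemma local_min_diff_ge0 (R : realType) (V : normedModType R) (f : V -> R)
    (S : set V) (z w : V) :
  differentiable f z -> local_minimizer f S z ->
  (\forall t \near 0^'+, S (z + t *: w)) -> 0 <= 'd f z w.
Proof.
move=> df [_ zmin] Sw; rewrite -deriveE//.
have ray : z + t *: w @[t --> (0 : R)^'+] --> z.
  have : z + t *: w @[t --> (0 : R)] --> z + (0 : R) *: w.
    by apply: cvgD; [exact: cvg_cst|apply: cvgZr_tmp; exact: cvg_id].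
  by rewrite scale0r addr0 => /cvg_at_right_filter.
have fray : \forall t \near 0^'+, S (z + t *: w) -> f z <= f (z + t *: w).
  exact: ray zmin.
have /cvg_dnbhs_at_right fw : derivable f z w by exact: diff_derivable.
rewrite /derive -(cvg_lim _ fw)//.
apply: limr_ge; first by apply/cvg_ex; eexists; exact: fw.
near=> t; apply: mulr_ge0; first by rewrite invr_ge0.
by rewrite subr_ge0 /= addrC; near: t; apply: filterS2 fray Sw => t; apply.
Unshelve. all: by end_near. Qed.

Lemma linear_dotv (R : realType) (k : nat) (L : 'cV[R]_k -> R) :
  (forall a u v, L (a *: u + v) = a * L u + L v) ->
  forall u, L u = dotv (\col_i L (delta_mx i 0)) u.
Proof.
move=> linL u.
have L0 : L 0 = 0.
  have := linL (-1) 0 0; rewrite scaler0 addr0 => ->.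
  by rewrite mulN1r addNr.
have LD v w : L (v + w) = L v + L w.
  by have := linL 1 v w; rewrite scale1r mul1r.
rewrite {1}[u]matrix_sum_delta (big_morph L LD L0) dotvE.
apply: eq_bigr => i _; rewrite big_ord1 mxE mulrC.
by have := linL (u i 0) (delta_mx i 0) 0; rewrite !addr0 L0 addr0.
Qed.

(** The partial gradients are defined by differentiating slices of [f]; the
    difference quotients of a slice are those of [f] along a basis vector with
    zero second (or first) component, so linearity of the differential does
    the rest. *)
Lemma diff_grad (R : realType) (n m : nat) (f : 'cV[R]_n * 'cV[R]_m -> R)
    (z w : 'cV[R]_n * 'cV[R]_m) :
  differentiable f z ->
  'd f z w = dotv (grad_x f z) w.1 + dotv (grad_y f z) w.2.
Proof.
move=> df; case: w => u v /=.
have -> : (u, v) = (u, 0) + (0, v) by congr pair; rewrite ?addr0 ?add0r.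
rewrite linearD/=; congr (_ + _).
  rewrite (linear_dotv (L := fun x => 'd f z (x, 0))).
    congr dotv; apply/matrixP => i j; rewrite !mxE -deriveE// /derive.
    case: z {df} => x y/=.
    apply: (congr1 (fun g => lim (g @ (0 : R)^'))); apply/funext => t/=.
    by congr (_ *: (f (_, _) - _)); rewrite /= scaler0 add0r.
  move=> a x y; rewrite -[a * _]/(a *: _) -linearP.
  by congr ('d f z _); congr pair; rewrite /= scaler0 addr0.
rewrite (linear_dotv (L := fun x => 'd f z (0, x))).
  congr dotv; apply/matrixP => i j; rewrite !mxE -deriveE// /derive.
  case: z {df} => x y/=.
  apply: (congr1 (fun g => lim (g @ (0 : R)^'))); apply/funext => t/=.
  by congr (_ *: (f (_, _) - _)); rewrite /= scaler0 add0r.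
move=> a x y; rewrite -[a * _]/(a *: _) -linearP.
by congr ('d f z _); congr pair; rewrite /= scaler0 addr0.
Qed.

(** * The lower-level linear program *)

(** Optimality of [y] is stationarity of the linear objective [dotv c] under
    the constraints [B *m y <= b - A *m x]; the multipliers form a dual optimal
    solution, and their complementarity is strong duality. *)
Lemma lp_dual_multiplier (R : realType) (n m p : nat) (A : 'M[R]_(p, n))
    (B : 'M[R]_(p, m)) (b : 'cV[R]_p) (c : 'cV[R]_m) x y :
  Psi A B b c x y ->
  exists2 l, nneg_orth l (b - A *m x - B *m y) & 0 = c + B^T *m l.
Proof.
move=> [xy ymin].
have [||l] := @linear_kkt R m p B (b - A *m x) y c.
- by apply/vle_subr/vle_slack.
- move=> w feas.
  (* one positive feasible step is enough, because the objective is linear *)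
  have [t [t0 ft]] : exists t : R,
      0 < t /\ vle (B *m (y + t *: w)) (b - A *m x).
    near (0 : R)^'+ => t; exists t; split => //.
    by near: t.
  have /ymin : lp_feasible A B b x (y + t *: w).
    by apply/vle_slack/vle_subr.
  by rewrite dotvDr dotvZr lerDl pmulr_rge0.
- by move=> ? ?; exists l.
Unshelve. all: by end_near. Qed.

(** Sufficiency of complementary slackness, with [l] kept fixed while [x]
    varies: dual feasibility of [l] does not involve [x], and weak duality
    makes every feasible [y] of zero duality gap optimal. The single inequality
    [dotv l _ <= 0] thus cuts out, by linear constraints, a set of pairs that
    are feasible for the bilevel problem. *)
Lemma Psi_complementary (R : realType) (n m p : nat) (A : 'M[R]_(p, n))
    (B : 'M[R]_(p, m)) (b : 'cV[R]_p) (c : 'cV[R]_m) l x y :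
  vle 0 l -> 0 = c + B^T *m l -> lp_feasible A B b x y ->
  dotv l (b - A *m x - B *m y) <= 0 -> Psi A B b c x y.
Proof.
move=> l0 cB xy lxy; split=> // y' xy'.
have cE v : dotv c v = - dotv l (B *m v).
  have -> : c = - (B^T *m l) by apply/eqP; rewrite -addr_eq0 -cB.
  by rewrite dotvC dotvNr dotvC dotv_trmx.
have : 0 <= dotv l (b - A *m x - B *m y').
  by apply: dotv_ge0 => //; apply/vle_slack.
move: lxy; rewrite !cE !dotvDr !dotvNr; lra.
Qed.

(** * Stationarity for the bilevel problem *)

Theorem proposition5p2 (R : realType) (n m p q : nat)
    (f : 'cV[R]_n * 'cV[R]_m -> R)
    (A : 'M[R]_(p, n)) (B : 'M[R]_(p, m)) (C : 'M[R]_(q, n)) (D : 'M[R]_(q, m))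
    (b : 'cV[R]_p) (c : 'cV[R]_m) (d : 'cV[R]_q)
    (xb : 'cV[R]_n) (yb : 'cV[R]_m)
    (f_C1 : continuously_differentiable f)
    (xyb_min : local_minimizer f (bilevel_feasible A B C D b c d) (xb, yb))
    (xb_int : interior (edom (vartheta A B b c)) xb) :
  exists (lambda lambda' : 'cV[R]_p) (mu : 'cV[R]_q) (sigma : R),
    0 <= sigma /\
    0 = grad_x f (xb, yb) + A^T *m (lambda - sigma *: lambda') + C^T *m mu /\
    0 = grad_y f (xb, yb) + B^T *m (lambda - sigma *: lambda') + D^T *m mu /\
    nneg_orth lambda (b - A *m xb - B *m yb) /\
    nneg_orth mu (d - C *m xb - D *m yb) /\
    0 = c + B^T *m lambda' /\
    nneg_orth lambda' (b - A *m xb - B *m yb).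
Proof.
have [df _ _] := f_C1.
have [[/= Cd Psixy] _] := xyb_min.
have [l' l'orth cB] := lp_dual_multiplier Psixy.
(* The linear system of the reduced problem; its last row says that the
   duality gap between [l'] and [y] is nonpositive. *)
pose G := col_mx (row_mx A B)
  (col_mx (row_mx C D) (row_mx (- (l'^T *m A)) (- (l'^T *m B)))).
pose h := col_mx b (col_mx d (- (l'^T *m b))).
have GE x y : h - G *m col_mx x y = col_mx (b - A *m x - B *m y)
    (col_mx (d - C *m x - D *m y) (- (l'^T *m (b - A *m x - B *m y)))).
  rewrite !mul_col_mx !mul_row_col !opp_col_mx !add_col_mx.
  rewrite !opprD !addrA !mulNmx !opprK !mulmxBr -!mulmxA !opprB.
  by congr (col_mx _ (col_mx _ _)); rewrite addrC [- _ + _]addrC.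
have Gxy : vle (G *m col_mx xb yb) h.
  apply/vle_subr; rewrite GE -2!col_mx0 !vle_col_mx; split; last split.
  - exact/vle_slack/Psixy.1.
  - exact/vle_slack.
  - move=> i; rewrite ord1 [X in _ <= X]mxE -/(dotv _ _).
    by rewrite l'orth.2 oppr0 mxE.
have [|l lorth gl] := @linear_kkt R _ _ G h _
  (col_mx (grad_x f (xb, yb)) (grad_y f (xb, yb))) Gxy.
  move=> w; rewrite -[w]vsubmxK; move: (usubmx w) (dsubmx w) => u v Gw.
  rewrite dotv_col_mx -[X in 0 <= X](diff_grad (u, v) (df _)).
  apply: local_min_diff_ge0 => //; first exact: xyb_min.
  apply: filterS Gw => t.
  rewrite scale_col_mx add_col_mx => /vle_subr.
  rewrite GE -2!col_mx0 !vle_col_mx => -[Ab' [Cd' l't]].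
  split=> /=; first exact/vle_slack.
  apply: (Psi_complementary l'orth.1 cB); first exact/vle_slack.
  have := l't 0; rewrite [X in X <= _]mxE [X in _ <= X]mxE -/(dotv _ _).
  by rewrite oppr_ge0.
(* the multiplier [s] of the duality gap constraint is the [sigma] sought *)
move: lorth gl; rewrite -[l]vsubmxK -[dsubmx l]vsubmxK.
move: (usubmx l) (usubmx (dsubmx l)) (dsubmx (dsubmx l)) => la mu s.
move/vle_subr: Gxy; rewrite GE => slack.
move=> /(nneg_orth_col_mx slack)[laorth].
move: slack; rewrite -col_mx0 vle_col_mx => -[_ slack].
move=> /(nneg_orth_col_mx slack)[muorth [s0 _]].
have penalty k (E : 'M[R]_(p, k)) :
    (- (l'^T *m E))^T *m s = - (s 0 0 *: (E^T *m l')).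
  by rewrite {1}(mx11_scalar s) mul_mx_scalar linearN/= trmx_mul trmxK scalerN.
have sum0 k (E : 'M[R]_(p, k)) (F : 'M[R]_(q, k)) g :
    g + (E^T *m la + (F^T *m mu - s 0 0 *: (E^T *m l'))) = 0 ->
    0 = g + E^T *m (la - s 0 0 *: l') + F^T *m mu.
  rewrite mulmxBr -scalemxAr => <-; rewrite -!addrA.
  by congr (_ + (_ + _)); rewrite addrC.
rewrite !tr_col_mx !tr_row_mx !mul_row_col !mul_col_mx !penalty !add_col_mx.
rewrite -col_mx0 => /eq_col_mx[/sum0 gx /sum0 gy].
exists la, l', mu, (s 0 0); do !split => //; try by case: laorth muorth l'orth.
by have := s0 0; rewrite mxE.
Qed.
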